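(* Let $d\ge 2$, let $\mathbb{F}_q$ be a finite field of odd characteristic, let $S_j=\{x\in\mathbb{F}_q^d : Q(x)=j\}$ with $j\in\mathbb{F}_q^*$ and $Q$ a non-degenerate quadratic form over $\mathbb{F}_q$, and let $E\subset S_j$. Then for every $p_0\ge 2$: (i) $\|\widehat{E d\sigma}\|_{L^r(\mathbb{F}_q^d,dm)}\lesssim \|E\|_{L^p(S_j,d\sigma)}$ for $1\lesssim \#E\lesssim q^{\frac{d-1}{2}}$, whenever \[p\ge \frac{(6d-2)p_0-8d+8}{(3d-5)p_0-4d+12}\quad\text{and}\quad r\ge \frac{(6d-2)p_0-8d+8}{(3d-3)p_0-4d+4};\] (ii) $\|\widehat{E d\sigma}\|_{L^r(\mathbb{F}_q^d,dm)}\lesssim \|E\|_{L^p(S_j,d\sigma)}$ for $1\lesssim \#E\lesssim q^{\frac{d+1}{2}}$, whenever \[p\ge \frac{(6d-10)p_0-8d+24}{(3d-9)p_0-4d+20}\quad\text{and}\quad r\ge \frac{(6d-10)p_0-8d+24}{(3d-7)p_0-4d+12}.\]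
   Context: $\chi$ is a fixed non-trivial additive character of $\mathbb{F}_q$. A quadratic form $Q(x)=\sum_{i,k=1}^d a_{ik}x_ix_k$ with $a_{ik}=a_{ki}\in\mathbb{F}_q$ is non-degenerate if the matrix $(a_{ik})$ is invertible. $E$ also denotes the indicator function of $E$. For $f:S_j\to\mathbb{C}$, $\widehat{fd\sigma}(m)=\frac{1}{\#S_j}\sum_{x\in S_j}\chi(-x\cdot m)f(x)$, and $\widehat{Ed\sigma}$ is this with $f=E$. Norms: $\|g\|_{L^r(\mathbb{F}_q^d,dm)}=\big(\sum_{m\in\mathbb{F}_q^d}|g(m)|^r\big)^{1/r}$, $\|f\|_{L^p(S_j,d\sigma)}=\big(\frac{1}{\#S_j}\sum_{x\in S_j}|f(x)|^p\big)^{1/p}$. $X\lesssim Y$ means $X\le CY$ for a constant $C$ independent of $q$ (and of $E$); size conditions like $1\lesssim\#E\lesssim q^{a}$ mean $c_1\le\#E\le c_2q^{a}$ for fixed constants $c_1,c_2>0$, the implied constant in the conclusion being allowed to depend on them.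
   Formalization: In (ii) both denominators (3d-9)p_0-4d+20 and (3d-7)p_0-4d+12 are assumed positive, which only excludes d=2 with p_0≥4, where the thresholds are undefined (p_0=4) or negative and the claim fails (e.g. p=r=1, E=S_j). *)

(* Defs.v *)
From HB Require Import structures.
From mathcomp Require Import all_boot all_order all_algebra all_field.
From mathcomp Require Import complex.
From mathcomp Require Import reals exp.
Set Implicit Arguments. Unset Strict Implicit. Unset Printing Implicit Defensive.
Import Order.TTheory GRing.Theory Num.Theory.
Local Open Scope ring_scope.

Section Defs.
Variable R : realType.
Variable F : finFieldType.
Variable d : nat.

Definition quad_form (A : 'M[F]_d) (x : 'rV[F]_d) : F :=
  \sum_(i < d) \sum_(k < d) A i k * x 0 i * x 0 k.

Definition qsphere (A : 'M[F]_d) (j : F) : {set 'rV[F]_d} :=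
  [set x : 'rV[F]_d | quad_form A x == j].

Definition dotv (x m : 'rV[F]_d) : F := \sum_(i < d) x 0 i * m 0 i.

Definition nontriv_add_char (chi : F -> R[i]) : Prop :=
  [/\ chi 0 = 1, (forall a b, chi (a + b) = chi a * chi b) & exists a, chi a != 1].

Definition ext_hat (chi : F -> R[i]) (S : {set 'rV[F]_d})
    (f : 'rV[F]_d -> R[i]) (m : 'rV[F]_d) : R[i] :=
  (#|S|%:R)^-1 * \sum_(x in S) chi (- dotv x m) * f x.

Definition indC (E : {set 'rV[F]_d}) (x : 'rV[F]_d) : R[i] := (x \in E)%:R.
Definition indR (E : {set 'rV[F]_d}) (x : 'rV[F]_d) : R := (x \in E)%:R.

Definition norm_Lr_dm (g : 'rV[F]_d -> R[i]) (r : R) : R :=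
  (\sum_(m : 'rV[F]_d) (Normc.normc (g m)) `^ r) `^ (r^-1).

Definition norm_Lp_dsigma (S : {set 'rV[F]_d}) (f : 'rV[F]_d -> R) (p : R) : R :=
  ((#|S|%:R)^-1 * \sum_(x in S) `|f x| `^ p) `^ (p^-1).

End Defs.

Arguments indC {R F d} E x.
Arguments indR {R F d} E x.

(* Main.v *)
Require Import Defs.
From HB Require Import structures.
From mathcomp Require Import all_boot all_order all_algebra all_field.
From mathcomp Require Import complex.
From mathcomp Require Import reals exp.
From mathcomp Require Import ring lra zify.
Set Implicit Arguments. Unset Strict Implicit. Unset Printing Implicit Defensive.
Import Order.TTheory GRing.Theory Num.Theory.
Local Open Scope ring_scope.

(** Write [n] for the size of [E], [q] for that of the field, and [a m] for the
    modulus of the unnormalised exponential sum of [E] at [m].  Then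
    [a m <= n], the second moment of [a] is [q^d n] and its fourth moment is
    [q^d] times the additive energy of [E].  Since the hypotheses on [p] and [r]
    are closed upwards and both norms are monotone, only the extreme exponents
    matter, and there each claim reduces to a bound on the [r]-th moment.

    For (i), bounding [a^r] by [n^(r-2) a^2] already gives the exact exponents.

    For (ii) with [d >= 3], [x + y = z + w] on the sphere forces
    [(x - z)] orthogonal to [(y - z)].  Stereographic projection from [z] turns the
    pairs [(x, y)] into solutions of a bilinear equation in the hyperplane
    orthogonal to [z], counted by character sums in dimension [d - 1]; hence the
    energy is at most a multiple of [n^3 / q + q^((d-1)/2) n^2].  Interpolating
    the second and fourth moments gives the exact exponents.  For [d = 2] the
    hyperplane is a line, the energy is at most [3 n^2], and
    [a^r <= n^(r-4) a^4] suffices.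

    The cardinality of the sphere is bounded below by reflecting a point of it
    in all non-isotropic directions. *)

(** * Additive characters *)

Section Characters.
Variables (R : realType) (F : finFieldType) (chi : F -> R[i]).
Hypothesis chiP : nontriv_add_char chi.

Let chi0 : chi 0 = 1. Proof. by case: chiP. Qed.
Let chiD a b : chi (a + b) = chi a * chi b. Proof. by case: chiP. Qed.

(** In characteristic [p] the [p]-fold sum of [a] vanishes, so [chi a] is a [p]-th root of unity. *)
Lemma chi_norm a : `|chi a| = 1.
Proof.
have [p p_pr pF] := finPcharP F.
have chiM n : chi (a *+ n) = chi a ^+ n.
  by elim: n => [|n IH]; rewrite ?mulr0n ?expr0 // mulrS chiD IH exprS.
have : `|chi a| ^+ p = 1 by rewrite -normrX -chiM mulrn_pchar // chi0 normr1.
by move/eqP; rewrite pexpr_eq1 ?prime_gt0 // => /eqP.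
Qed.

Lemma chi_conj a : conjc (chi a) = chi (- a).
Proof.
have h : chi a * conjc (chi a) = 1 by rewrite -sqr_normc chi_norm expr1n.
have nz : chi a != 0 by rewrite -normr_eq0 chi_norm oner_eq0.
by apply: (mulfI nz); rewrite h -chiD subrr chi0.
Qed.

Lemma chi_scale (e t : F) : e != 0 -> t != 0 -> exists b, chi (t * (b * e)) != 1.
Proof.
move=> e0 t0; have [_ _ [a ha]] := chiP; exists (t^-1 * (a / e)).
by rewrite -mulrA divfK // mulVKf.
Qed.

(** Translation by [h] permutes [H] and multiplies the sum by [psi h], which is not 1. *)
Lemma sum_shift_eq0 (V : finZmodType) (H : {set V}) (psi : V -> R[i]) (h : V) :
  (forall x, (x + h \in H) = (x \in H)) ->
  (forall x, psi (x + h) = psi h * psi x) -> psi h != 1 ->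
  \sum_(x in H) psi x = 0.
Proof.
move=> hH hpsi h1.
have e : \sum_(x in H) psi x = psi h * \sum_(x in H) psi x.
  rewrite [LHS](reindex_inj (addIr h)) /=.
  by rewrite mulr_sumr; apply: eq_big => // x; rewrite ?hH ?hpsi.
apply/eqP; move/eqP: e; rewrite -subr_eq0 -{1}[X in X - _]mul1r -mulrBl mulf_eq0.
by rewrite subr_eq0 eq_sym (negPf h1).
Qed.

(** Expand the square and sum over [v] first: by orthogonality only the pairs related by [P]
    survive. Equality as [P] gives second moments, equality of sums of pairs gives the fourth. *)
Lemma second_moment (T I : finType) (H : {set T}) (W : {set I})
    (g : T -> I -> F) (P : rel I) :
  (forall w w', w \in W -> w' \in W ->
     \sum_(v in H) chi (g v w - g v w') = if P w w' then #|H|%:R else 0) ->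
  \sum_(v in H) Normc.normc (\sum_(w in W) chi (g v w)) ^+ 2
    = (#|H| * #|[set p in setX W W | P p.1 p.2]|)%:R :> R.
Proof.
move=> hP; apply: (@complexI R); rewrite rmorph_sum rmorph_nat /=.
transitivity (\sum_(v in H) \sum_(w in W) \sum_(w' in W) chi (g v w - g v w')).
  apply: eq_bigr => v _; rewrite rmorphXn; transitivity (`|\sum_(w in W) chi (g v w)| ^+ 2); first by [].
  rewrite sqr_normc.
  rewrite rmorph_sum /= big_distrl /=; apply: eq_bigr => w _.
  rewrite big_distrr /=; apply: eq_bigr => w' _.
  by rewrite chi_conj -chiD.
rewrite exchange_big natrM [RHS]mulrC -(sum1_card (mem [set p in setX W W | P p.1 p.2])) natr_sum mulr_suml /=.
under [RHS]eq_bigl => p do rewrite !inE.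
rewrite big_mkcondr -(pair_big (mem W) (mem W) (fun w w' => if P w w' then 1 * #|H|%:R else 0)) /=.
apply: eq_bigr => w wW; rewrite exchange_big; apply: eq_bigr => w' w'W.
by rewrite hP // mul1r.
Qed.
End Characters.

(** * Bilinear forms *)

Section BilinearForm.
Variables (F : finFieldType) (d : nat) (A : 'M[F]_d).
Implicit Types x y z : 'rV[F]_d.

Definition bform x y : F := (x *m A *m y^T) 0 0.

Lemma bformE x y : bform x y = \sum_(i < d) \sum_(k < d) A i k * x 0 i * y 0 k.
Proof.
rewrite /bform mxE exchange_big; apply: eq_bigr => k _.
rewrite !mxE big_distrl; apply: eq_bigr => i _ /=.
by rewrite (mulrC (A i k)).
Qed.

Lemma quad_formE x : quad_form A x = bform x x.
Proof. by rewrite bformE. Qed.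

Lemma bformDl x x' y : bform (x + x') y = bform x y + bform x' y.
Proof. by rewrite /bform !mulmxDl mxE. Qed.

Lemma bformZl a x y : bform (a *: x) y = a * bform x y.
Proof. by rewrite /bform -!scalemxAl mxE. Qed.

Lemma bformDr x y y' : bform x (y + y') = bform x y + bform x y'.
Proof. by rewrite /bform linearD /= mulmxDr mxE. Qed.

Lemma bformZr a x y : bform x (a *: y) = a * bform x y.
Proof. by rewrite /bform linearZ /= -scalemxAr mxE. Qed.

Lemma bformNl x y : bform (- x) y = - bform x y.
Proof. by rewrite -scaleN1r bformZl mulN1r. Qed.

Lemma bformNr x y : bform x (- y) = - bform x y.
Proof. by rewrite -scaleN1r bformZr mulN1r. Qed.


Lemma bformC : A^T = A -> forall x y, bform x y = bform y x.
Proof.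
move=> As x y; rewrite !bformE exchange_big; apply: eq_bigr => k _.
apply: eq_bigr => i _.
by rewrite -[A]As mxE As mulrAC.
Qed.

Lemma bform_nondeg x : A \in unitmx -> x != 0 -> exists y, bform y x != 0.
Proof.
move=> Au x0.
have : A *m x^T != 0.
  apply: contraNneq x0 => h; rewrite -(trmxK x) -[x^T](mulKmx Au) h mulmx0.
  by rewrite linear0.
move=> h; have [i hi] : exists i, (A *m x^T) i 0 != 0.
  apply/existsP; apply: contraNT h; rewrite negb_exists => /forallP h0.
  apply/eqP/matrixP => i k; rewrite ord1 [RHS]mxE.
  by apply/eqP; rewrite -[_ == _]negbK; exact: h0.
exists (delta_mx 0 i); rewrite /bform -mulmxA -rowE mxE.
exact: hi.
Qed.

End BilinearForm.

(** * Bilinear character sums in a hyperplane *)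

Lemma normc_ge0 (R : realType) (x : R[i]) : 0 <= Normc.normc x.
Proof. by rewrite -lecR; exact: (normr_ge0 x). Qed.

Lemma le_normc_sum (R : realType) (I : Type) (s : seq I) (P : pred I) (f : I -> R[i]) :
  Normc.normc (\sum_(i <- s | P i) f i) <= \sum_(i <- s | P i) Normc.normc (f i).
Proof.
elim/big_ind2: _ => [|x1 x2 y1 y2 h1 h2|//]; first by rewrite Normc.normc0.
exact: le_trans (le_normcD x2 y2) (lerD h1 h2).
Qed.

(** Cauchy-Schwarz against the constant 1, read off from the nonnegative sum of the
    [(n * a i - s) ^+ 2]. *)
Lemma sqr_sum_le_card (R : realFieldType) (I : finType) (X : {set I}) (a : I -> R) :
  (\sum_(i in X) a i) ^+ 2 <= #|X|%:R * \sum_(i in X) a i ^+ 2.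
Proof.
have [->|X0] := eqVneq X set0; first by rewrite !big_set0 expr2 !mulr0.
have n0 : 0 < #|X|%:R :> R by rewrite ltr0n card_gt0.
set s := \sum_(i in X) a i; set q := \sum_(i in X) a i ^+ 2; set n := #|X|%:R in n0 *.
have : 0 <= \sum_(i in X) (n * a i - s) ^+ 2 by apply: sumr_ge0 => i _; exact: sqr_ge0.
have -> : \sum_(i in X) (n * a i - s) ^+ 2 = n * (n * q - s ^+ 2).
  rewrite (eq_bigr (fun i => n ^+ 2 * a i ^+ 2 + (- (2 * n * s) * a i + s ^+ 2))); last first.
    by move=> i _; ring.
  rewrite big_split big_split /= sumr_const -[s ^+ 2 *+ _]mulr_natr -!mulr_sumr -/s -/q -/n.
  ring.
by rewrite pmulr_rge0 // subr_ge0.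
Qed.

Lemma card_diag (I : finType) (W : {set I}) :
  #|[set p in setX W W | p.1 == p.2]| = #|W|.
Proof.
rewrite -(card_imset W (f := fun x => (x, x))); last by move=> x y [].
apply: eq_card => -[x y]; rewrite !inE /=; apply/idP/imsetP.
  by case/andP=> /andP[xW _] /eqP <-; exists x.
by case=> w wW [-> ->]; rewrite wW eqxx.
Qed.

Section Orthogonal.
Variables (R : realType) (F : finFieldType) (d : nat) (A : 'M[F]_d).
Hypotheses (Asym : A^T = A) (Aunit : A \in unitmx).
Variable z : 'rV[F]_d.
Hypothesis z0 : bform A z z != 0.
Local Notation B := (bform A).

Definition orthoset : {set 'rV[F]_d} := [set v | B v z == 0].

(** As [z] is anisotropic, pairing [u + s *: z] with [z] recovers [s], and then [u]. *)
Lemma card_orthoset : (#|orthoset| * #|F| <= #|F| ^ d)%N.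
Proof.
have <- : #|'rV[F]_d| = (#|F| ^ d)%N by rewrite card_mx mul1n.
rewrite -cardsT -cardsX -(card_in_imset (f := fun p : 'rV[F]_d * F => p.1 + p.2 *: z)).
  exact: max_card.
move=> [u s] [v t]; rewrite !inE !andbT /= => /eqP hu /eqP hv e.
have st : s = t.
  have := congr1 (B ^~ z) e; rewrite /= !bformDl hu hv !add0r !bformZl.
  exact: (mulIf z0).
by move: e; rewrite st => /addIr ->.
Qed.

(** The form stays nondegenerate on the hyperplane: removing from [y] its component along [z] does
    not change its pairing with [e], which is orthogonal to [z]. *)
Lemma orthoset_nondeg e : e \in orthoset -> e != 0 ->
  exists2 v, v \in orthoset & B v e != 0.
Proof.
rewrite inE => /eqP ez e0; have [y hy] := bform_nondeg Aunit e0.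
exists (y - (B y z / B z z) *: z).
  by rewrite inE bformDl bformNl bformZl divfK // subrr.
by rewrite bformDl bformNl bformZl (bformC Asym z) ez mulr0 subr0.
Qed.

Variable chi : F -> R[i].
Hypothesis chiP : nontriv_add_char chi.

Let chi0 : chi 0 = 1. Proof. by case: chiP. Qed.
Let chiD a b : chi (a + b) = chi a * chi b. Proof. by case: chiP. Qed.

Lemma chi_sum_orthoset (t : F) (e : 'rV[F]_d) : t != 0 -> e \in orthoset -> e != 0 ->
  \sum_(v in orthoset) chi (t * B v e) = 0.
Proof.
move=> t0 eU e0; have [v vU ve0] := orthoset_nondeg eU e0.
have [b hb] := chi_scale chiP ve0 t0.
apply: (@sum_shift_eq0 R _ _ (fun v => chi (t * B v e)) (b *: v)).
- by move=> x; move: vU; rewrite !inE bformDl bformZl => /eqP ->; rewrite mulr0 addr0.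
- by move=> x; rewrite bformDl mulrDr chiD mulrC.
- by rewrite bformZl.
Qed.

Lemma chi_sum_field (a : F) : \sum_t chi (t * a) = if a == 0 then #|F|%:R else 0.
Proof.
case: eqVneq => [->|a0].
  by under eq_bigr do rewrite mulr0 chi0; rewrite sumr_const.
have [b hb] := chi_scale chiP a0 (oner_neq0 F).
transitivity (\sum_(t in [set: F]) chi (t * a)).
  by apply: eq_bigl => t; rewrite inE.
apply: (@sum_shift_eq0 R _ _ (fun v => chi (v * a)) b).
- by move=> x; rewrite !inE.
- by move=> x; rewrite mulrDl chiD mulrC.
- by rewrite -[b * a]mul1r.
Qed.

Section Count.
Variables (X Y : {set 'rV[F]_d}) (f g : 'rV[F]_d -> 'rV[F]_d).
Hypotheses (finj : {in X &, injective f}) (ginj : {in Y &, injective g}).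
Hypotheses (fU : {in X, forall x, f x \in orthoset}) (gU : {in Y, forall x, g x \in orthoset}).

(** Cauchy-Schwarz in [x], then enlarge the sum of squares from [f @: X] to the whole hyperplane.
    There orthogonality leaves only the diagonal, [g] being injective on [Y]. *)
Lemma bilinear_chi_sum_le (t : F) : t != 0 ->
  Normc.normc (\sum_(x in X) \sum_(y in Y) chi (t * B (f x) (g y)))
    <= Num.sqrt (#|orthoset| * #|X| * #|Y|)%:R.
Proof.
move=> t0; set phi := fun v => Normc.normc (\sum_(y in Y) chi (t * B v (g y))).
have h2 : \sum_(v in orthoset) phi v ^+ 2 = (#|orthoset| * #|Y|)%:R.
  rewrite -(card_diag Y).
  apply: (@second_moment R F chi chiP _ _ _ _ (fun v y => t * B v (g y)) eq_op).
  move=> w w' wY w'Y; case: eqVneq => [->|ne].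
    by under eq_bigr do rewrite subrr chi0; rewrite sumr_const.
  under eq_bigr do rewrite -mulrBr -bformNr -bformDr.
  apply: chi_sum_orthoset => //; last by rewrite subr_eq0; apply: contra ne => /eqP/ginj ->.
  by move: (gU wY) (gU w'Y); rewrite !inE bformDl bformNl => /eqP -> /eqP ->; rewrite subr0.
apply: (le_trans (le_normc_sum _ _ _)).
rewrite -[leLHS]ger0_norm; last by apply: sumr_ge0 => x _; exact: normc_ge0.
rewrite -sqrtr_sqr ler_sqrt //.
apply: (le_trans (sqr_sum_le_card _ _)).
rewrite mulnAC mulnC natrM ler_wpM2l // -h2.
rewrite -(big_imset (fun v => phi v ^+ 2) finj) /=.
rewrite [leRHS](big_setID (f @: X)) /= (setIidPr _).
  by rewrite lerDl sumr_ge0 // => x _; exact: sqr_ge0.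
by apply/subsetP => _ /imsetP[x xX ->]; exact: fU.
Qed.

(** The equation is detected by a character sum over [t]. The term [t = 0] gives the expected count,
    and each other [t] is controlled by [bilinear_chi_sum_le]. *)
Lemma bform_eq_count_le (c : F) :
  (#|F| * #|[set p in setX X Y | B (f p.1) (g p.2) == c]|)%:R
   <= (#|X| * #|Y|)%:R + #|F|%:R * Num.sqrt (#|orthoset| * #|X| * #|Y|)%:R :> R.
Proof.
set S := fun t => \sum_(x in X) \sum_(y in Y) chi (t * B (f x) (g y)).
have e : (#|F| * #|[set p in setX X Y | B (f p.1) (g p.2) == c]|)%:R
         = \sum_t chi (- (t * c)) * S t.
  transitivity (\sum_(x in X) \sum_(y in Y) \sum_t chi (t * (B (f x) (g y) - c))).
    rewrite natrM mulrC -(sum1_card (mem [set p in setX X Y | _])) natr_sum mulr_suml /=.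
    under [LHS]eq_bigl => p do rewrite !inE.
    rewrite big_mkcondr -(pair_big (mem X) (mem Y)
      (fun x y => if B (f x) (g y) == c then 1 * #|F|%:R else 0)) /=.
    apply: eq_bigr => x _; apply: eq_bigr => y _.
    by rewrite chi_sum_field subr_eq0 mul1r.
  transitivity (\sum_(x in X) \sum_t \sum_(y in Y) chi (t * (B (f x) (g y) - c))).
    by apply: eq_bigr => x _; rewrite exchange_big.
  rewrite exchange_big /=; apply: eq_bigr => t _; rewrite mulr_sumr.
  apply: eq_bigr => x _; rewrite mulr_sumr; apply: eq_bigr => y _.
  by rewrite -chiD mulrBr addrC.
have -> : (#|F| * #|[set p in setX X Y | B (f p.1) (g p.2) == c]|)%:R
         = Normc.normc (\sum_t chi (- (t * c)) * S t) :> R.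
  by rewrite -e; apply: (@complexI R); rewrite rmorph_nat; exact/esym/(normr_nat R[i]).
apply: (le_trans (le_normc_sum _ _ _)).
have nchi a : Normc.normc (chi a) = 1.
  by apply: (@complexI R); rewrite rmorph1; exact: (chi_norm chiP a).
have -> : \sum_t Normc.normc (chi (- (t * c)) * S t) = \sum_t Normc.normc (S t).
  by apply: eq_bigr => t _; rewrite Normc.normcM nchi mul1r.
rewrite (bigD1 0) //=; apply: lerD.
  rewrite le_eqVlt; apply/orP; left; apply/eqP; apply: (@complexI R); rewrite rmorph_nat.
  transitivity (`|S 0|) => //; rewrite /S.
  under eq_bigr do under eq_bigr do rewrite mul0r chi0.
  by rewrite !sumr_const -mulrnA mulnC normr_nat.
apply: (@le_trans _ _ (\sum_(t : F | t != 0) Num.sqrt (#|orthoset| * #|X| * #|Y|)%:R)).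
  by apply: ler_sum => t t0; exact: bilinear_chi_sum_le.
rewrite sumr_const -[leLHS]mulr_natl ler_wpM2r ?sqrtr_ge0 // ler_nat.
exact: max_card.
Qed.
End Count.
End Orthogonal.

(** * Moments of exponential sums *)

Section Moments.
Variables (R : realType) (F : finFieldType) (d : nat) (chi : F -> R[i]).
Hypothesis chiP : nontriv_add_char chi.
Variable E : {set 'rV[F]_d}.

Let chi0 : chi 0 = 1. Proof. by case: chiP. Qed.
Let chiD a b : chi (a + b) = chi a * chi b. Proof. by case: chiP. Qed.

Definition expsum (m : 'rV[F]_d) : R[i] := \sum_(x in E) chi (- dotv x m).

Definition add_energy : nat :=
  #|[set p in setX (setX E E) (setX E E) | p.1.1 + p.1.2 == p.2.1 + p.2.2]|.

Lemma dotvE (x m : 'rV[F]_d) : dotv x m = bform 1%:M x m.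
Proof.
by rewrite /dotv /bform mulmx1 mxE; apply: eq_bigr => i _; rewrite [in RHS]mxE.
Qed.

Lemma chi_sum_dotv (e : 'rV[F]_d) :
  \sum_(m in [set: 'rV[F]_d]) chi (- dotv e m) = if e == 0 then #|[set: 'rV[F]_d]|%:R else 0.
Proof.
case: eqVneq => [->|e0].
  rewrite -sumr_const; apply: eq_bigr => m _.
  by rewrite dotvE -(scale0r 0) bformZl mul0r oppr0.
have [y hy] := bform_nondeg (unitmx1 F d) e0.
have [b hb] := chi_scale chiP hy (oner_neq0 F).
apply: (@sum_shift_eq0 R _ _ (fun m => chi (- dotv e m)) (- b *: y)).
- by move=> x; rewrite !inE.
- by move=> x; rewrite !dotvE bformDr opprD chiD mulrC.
- by rewrite dotvE bformZr (bformC (trmx1 F d)) mulNr opprK -[b * _]mul1r.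
Qed.

Lemma card_space : #|[set: 'rV[F]_d]| = (#|F| ^ d)%N.
Proof. by rewrite cardsT card_mx mul1n. Qed.

Lemma expsum_sqr : \sum_m Normc.normc (expsum m) ^+ 2 = (#|F| ^ d * #|E|)%:R :> R.
Proof.
rewrite -card_space -(card_diag E).
rewrite -(@second_moment R F chi chiP _ _ _ _ (fun m x => - dotv x m) eq_op).
  by apply: eq_bigl => m; rewrite inE.
move=> x y _ _; rewrite -subr_eq0 -chi_sum_dotv; apply: eq_bigr => m _.
by rewrite !dotvE bformDl bformNl opprD.
Qed.

(** The square of [expsum] is an exponential sum over pairs with phase [p.1 + p.2], so this is again
    a second moment. *)
Lemma expsum_pow4 : \sum_m Normc.normc (expsum m) ^+ 4 = (#|F| ^ d * add_energy)%:R :> R.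
Proof.
rewrite -card_space.
rewrite -(@second_moment R F chi chiP _ _ _ _ (fun m p => - dotv (p.1 + p.2) m)
  (fun p p' => p.1 + p.2 == p'.1 + p'.2)).
  apply: eq_big => [m|m _]; first by rewrite inE.
  rewrite (exprM _ 2 2) (expr2 (Normc.normc _)) -Normc.normcM; congr (Normc.normc _ ^+ 2).
  rewrite big_distrlr /= pair_big /=; apply: eq_big => [p|p _]; first by rewrite inE.
  by rewrite -chiD !dotvE bformDl opprD.
move=> p p' _ _; rewrite -subr_eq0 -chi_sum_dotv; apply: eq_bigr => m _.
by rewrite !dotvE !bformDl bformNl !bformDl !opprD.
Qed.

Lemma normc_expsum_le m : Normc.normc (expsum m) <= #|E|%:R.
Proof.
apply: (le_trans (le_normc_sum _ _ _)).
rewrite -sum1_card natr_sum; apply: ler_sum => x _.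
by rewrite le_eqVlt; apply/orP; left; apply/eqP/(@complexI R); exact: (chi_norm chiP).
Qed.

End Moments.

(** * Additive energy on the sphere *)

Section Energy.
Variables (R : realType) (F : finFieldType) (d : nat) (A : 'M[F]_d).
Hypotheses (F2 : 2%N \notin [pchar F]) (Asym : A^T = A) (Aunit : A \in unitmx).
Variable j : F.
Hypothesis j0 : j != 0.
Variable E : {set 'rV[F]_d}.
Hypothesis ES : E \subset qsphere A j.
Local Notation B := (bform A).

Lemma two_neq0 : 2 != 0 :> F.
Proof. by move: F2; rewrite inE /=. Qed.

Lemma qsphere_bform x : x \in qsphere A j -> B x x = j.
Proof. by rewrite inE quad_formE => /eqP. Qed.

Let EQ x : x \in E -> B x x = j.
Proof. by move/(subsetP ES)/qsphere_bform. Qed.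

Lemma bform_sqrD x y : B (x + y) (x + y) = B x x + 2 * B x y + B y y.
Proof. by rewrite !bformDl !bformDr (bformC Asym y x); ring. Qed.

Definition right_pairs z : {set 'rV[F]_d * 'rV[F]_d} :=
  [set p in setX E E | B (p.1 - z) (p.2 - z) == 0].

(** In [x + y = z + w] the triple [(z, (x, y))] determines [w]. Writing [w = (x - z) + (y - z) + z]
    and using that all four points lie on the sphere leaves [2 * B (x - z) (y - z) = 0]. *)
Lemma add_energy_le : (add_energy E <= \sum_(z in E) #|right_pairs z|)%N.
Proof.
pose D := [set p : 'rV[F]_d * ('rV[F]_d * 'rV[F]_d) | (p.1 \in E) && (p.2 \in right_pairs p.1)].
have -> : (\sum_(z in E) #|right_pairs z| = #|D|)%N.
  rewrite -sum1_card (eq_bigr (fun z => \sum_(p in right_pairs z) 1)%N); last first.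
    by move=> z _; rewrite sum1_card.
  by rewrite pair_big_dep /=; apply: eq_bigl => p; rewrite [in RHS]inE.
rewrite /add_energy -(card_in_imset (f := fun p => (p.2.1, p.1))).
  apply: subset_leq_card; apply/subsetP => _ /imsetP[[[x y] [z w]] + ->].
  rewrite !inE /= => /andP[/andP[/andP[xE yE] /andP[zE wE]] /eqP e].
  rewrite xE yE zE /=.
  have hw : w = (x - z) + (y - z) + z.
    by apply: (addrI z); rewrite -e -(addrA (x - z)) subrK addrA [z + _]addrC subrK.
  have shift v : B v v = B (v - z) (v - z) + 2 * B (v - z) z + B z z.
    by rewrite -bform_sqrD subrK.
  have hx := EQ xE; have hy := EQ yE; have hz := EQ zE; have h := EQ wE.
  rewrite shift in hx; rewrite shift in hy.
  rewrite hw bform_sqrD (bform_sqrD (x - z)) (bformDl A (x - z)) in h.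
  (* With [u = x - z] and [v = y - z], the letters stand for [B u u], [B u z], [B v v], [B v z] and
     [B u v]. *)
  have arith (a b c g f : F) : a + 2 * b + j = j -> c + 2 * g + j = j ->
      a + 2 * f + c + 2 * (b + g) + j = j -> 2 * f = 0.
    move=> h1 h2 h3.
    have -> : 2 * f = (a + 2 * f + c + 2 * (b + g) + j) - (a + 2 * b + j) - (c + 2 * g + j) + j.
      by ring.
    by rewrite h3 h1 h2; ring.
  rewrite hz in hx hy h; have := arith _ _ _ _ _ hx hy h.
  by move/eqP; rewrite mulf_eq0 (negPf two_neq0).
move=> [[x y] [z w]] [[x' y'] [z' w']]; rewrite !inE /= => /andP[_ /eqP e] /andP[_ /eqP e'].
by case=> hz hx hy; move: e e'; rewrite hz hx hy => -> /addrI ->.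
Qed.

(** * Stereographic projection from a point of [E] *)

Section Stereographic.
Variable z : 'rV[F]_d.
Hypothesis zE : z \in E.

Let Qz : B z z = j := EQ zE.
Let z0 : B z z != 0. Proof. by rewrite Qz. Qed.

(* Every [x] with [B (x - z) z != 0] is [z + a *: (stereo x + z)], where
   [stereo x] is orthogonal to [z] and [a = B (x - z) z / j]. *)
Definition stereo x := (j / B (x - z) z) *: (x - z) - z.

Lemma stereo_orthoset x : B (x - z) z != 0 -> stereo x \in orthoset A z.
Proof. by move=> h; rewrite inE bformDl bformNl bformZl divfK // Qz subrr. Qed.

Lemma stereoK x : B (x - z) z != 0 -> x - z = (B (x - z) z / j) *: (stereo x + z).
Proof.
by move=> h; rewrite subrK scalerA mulrA divfK // divff // scale1r.
Qed.

(** The line through [z] in direction [stereo x + z] meets the sphere once more: its parameter [a]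
    satisfies [a * (B v v + j) = - (2 * j)] with [v = stereo x]. The right side is nonzero, so [v]
    determines [a] and hence [x]. *)
Lemma stereo_inj : {in [set x in E | B (x - z) z != 0] &, injective stereo}.
Proof.
have key x : x \in E -> B (x - z) z != 0 ->
    (B (x - z) z / j) * (B (stereo x) (stereo x) + j) = - (2 * j).
  move=> xE h; set a := B (x - z) z / j.
  have a0 : a != 0 by rewrite mulf_neq0 // invr_eq0.
  have xzv := stereoK h; rewrite -/a in xzv.
  have := stereo_orthoset h; rewrite inE => /eqP vz; 
  have : B (x - z + z) (x - z + z) = j by rewrite subrK EQ.
  rewrite xzv bform_sqrD !bformZl !bformZr (bform_sqrD (stereo x) z) (bformDl A (stereo x) z) vz Qz => e.
  apply: (mulfI a0); set b := B (stereo x) _ in e *.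
  have -> : a * (a * (b + j)) = (a * (a * (b + 2 * 0 + j)) + 2 * (a * (0 + j)) + j) - 2 * (a * j) - j.
    by ring.
  by rewrite e; ring.
move=> x y; rewrite !inE => /andP[xE hx] /andP[yE hy] e.
have := key _ xE hx; rewrite -(key _ yE hy) e => /mulIf ha.
apply: (addIr (- z)); rewrite (stereoK hx) (stereoK hy) e ha //.
apply/eqP => h0; have := key _ yE hy; rewrite h0 mulr0 => /esym/eqP.
by rewrite oppr_eq0 mulf_eq0 (negPf two_neq0) (negPf j0).
Qed.

Variable chi : F -> R[i].
Hypothesis chiP : nontriv_add_char chi.

(** Each of the two points is either projected by [stereo] or lies in the tangent hyperplane at [z],
    where [x - z] is already orthogonal to [z]. The factor 4 counts the resulting cases, each a
    bilinear equation in [orthoset A z]. *)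
Lemma right_pairs_le :
  (#|F| * #|right_pairs z|)%:R
    <= 4 * ((#|E| ^ 2)%:R + #|F|%:R * (Num.sqrt #|orthoset A z|%:R * #|E|%:R)) :> R.
Proof.
pose E1 := [set x in E | B (x - z) z != 0].
pose E0 := [set x in E | B (x - z) z == 0].
have E1E : E1 \subset E by apply/subsetP => x; rewrite inE => /andP[].
have E0E : E0 \subset E by apply/subsetP => x; rewrite inE => /andP[].
have U1 : {in E1, forall x, stereo x \in orthoset A z}.
  by move=> x; rewrite inE => /andP[_]; exact: stereo_orthoset.
have U0 : {in E0, forall x, x - z \in orthoset A z}.
  by move=> x; rewrite !inE => /andP[].
have I0 : {in E0 &, injective (fun x => x - z)} by move=> x y _ _; exact: addIr.
have count (X Y : {set 'rV[F]_d}) f g c : X \subset E -> Y \subset E ->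
    {in X &, injective f} -> {in Y &, injective g} ->
    {in X, forall x, f x \in orthoset A z} -> {in Y, forall x, g x \in orthoset A z} ->
    (#|F| * #|[set p in setX X Y | B (f p.1) (g p.2) == c]|)%:R
     <= (#|E| ^ 2)%:R + #|F|%:R * (Num.sqrt #|orthoset A z|%:R * #|E|%:R) :> R.
  move=> XE YE fi gi fU gU.
  have XY : (#|X| * #|Y| <= #|E| ^ 2)%N by rewrite -mulnn leq_mul // subset_leq_card.
  apply: (le_trans (bform_eq_count_le Asym Aunit z0 chiP fi gi fU gU c)).
  apply: lerD; first by rewrite ler_nat.
  rewrite ler_wpM2l // -mulnA natrM sqrtrM // ler_wpM2l ?sqrtr_ge0 //.
  rewrite -[leRHS]ger0_norm // -sqrtr_sqr ler_sqrt ?sqr_ge0 // -natrX ler_nat.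
  exact: XY.
(* The value [- j] arises because [stereo x + z] and [stereo y + z] are orthogonal and both
   projections are orthogonal to [z], where [B z z = j]. In the mixed cases this contribution of [z]
   vanishes. *)
pose P11 := [set p in setX E1 E1 | B (stereo p.1) (stereo p.2) == - j].
pose P10 := [set p in setX E1 E0 | B (stereo p.1) (p.2 - z) == 0].
pose P01 := [set p in setX E0 E1 | B (p.1 - z) (stereo p.2) == 0].
pose P00 := [set p in setX E0 E0 | B (p.1 - z) (p.2 - z) == 0].
have cover : right_pairs z \subset (P11 :|: P10) :|: (P01 :|: P00).
  apply/subsetP => -[x y]; rewrite !inE /= => /andP[/andP[xE yE] e].
  rewrite xE yE /= e !andbT.
  case: (eqVneq (B (x - z) z) 0) => hx; case: (eqVneq (B (y - z) z) 0) => hy //=; rewrite ?orbT //.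
  - have h := stereo_orthoset hy; move: e; rewrite (stereoK hy) bformZr mulf_eq0.
    by rewrite mulf_eq0 invr_eq0 (negPf hy) (negPf j0) /= (bformDr A (x - z)) hx addr0 => ->; rewrite ?orbT.
  - have h := stereo_orthoset hx; move: e; rewrite (stereoK hx) bformZl mulf_eq0.
    rewrite mulf_eq0 invr_eq0 (negPf hx) (negPf j0) /= (bformDl A (stereo x) z) (bformC Asym z) hy addr0.
    by move=> ->; rewrite ?orbT.
  - have := stereo_orthoset hx; have := stereo_orthoset hy; rewrite !inE => /eqP vy /eqP vx.
    move: e; rewrite {1}(stereoK hx) {1}(stereoK hy) bformZl bformZr !mulf_eq0.
    rewrite !invr_eq0 (negPf hx) (negPf hy) (negPf j0) /= (bformDl A (stereo x) z) (bformDr A (stereo x)) (bformDr A z).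
    rewrite vx (bformC Asym z) vy Qz !addr0 add0r => /eqP h.
    by rewrite -subr_eq0 opprK h eqxx.
have c4 : (#|right_pairs z| <= (#|P11| + #|P10|) + (#|P01| + #|P00|))%N.
  apply: (leq_trans (subset_leq_card cover)); apply: (leq_trans (leq_card_setU _ _)).
  by apply: leq_add; exact: leq_card_setU.
have h11 := count _ _ _ _ (- j) E1E E1E stereo_inj stereo_inj U1 U1.
have h10 := count _ _ _ _ 0 E1E E0E stereo_inj I0 U1 U0.
have h01 := count _ _ _ _ 0 E0E E1E I0 stereo_inj U0 U1.
have h00 := count _ _ _ _ 0 E0E E0E I0 I0 U0 U0.
apply: (@le_trans _ _ (#|F| * ((#|P11| + #|P10|) + (#|P01| + #|P00|)))%:R).
  by rewrite ler_nat leq_mul2l c4 orbT.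
rewrite !mulnDr !natrD /=.
move: h11 h10 h01 h00; rewrite -/P11 -/P10 -/P01 -/P00.
set t := _ + _; lra.
Qed.

End Stereographic.

Variable chi : F -> R[i].
Hypothesis chiP : nontriv_add_char chi.

(** Divide [right_pairs_le] by the field size and sum over [z]; [card_orthoset] bounds the
    hyperplane by [#|F| ^ d.-1]. *)
Lemma add_energy_bound : (0 < d)%N ->
  (add_energy E)%:R <= 4 * (#|E|%:R ^+ 3 / #|F|%:R + Num.sqrt (#|F| ^ d.-1)%:R * #|E|%:R ^+ 2) :> R.
Proof.
move=> d0.
have q0 : 0 < #|F|%:R :> R by rewrite ltr0n; apply/card_gt0P; exists 0.
have hz z : z \in E -> (#|right_pairs z|)%:R
    <= 4 * (#|E|%:R ^+ 2 / #|F|%:R + Num.sqrt (#|F| ^ d.-1)%:R * #|E|%:R) :> R.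
  move=> zE; rewrite -(ler_pM2l q0) -natrM; apply: (le_trans (right_pairs_le zE chiP)).
  rewrite [leRHS]mulrCA; apply: ler_wpM2l => //; rewrite mulrDr natrX [X in _ <= X + _]mulrC divfK ?gt_eqF //.
  rewrite lerD2l; apply: ler_wpM2l; first exact: ltW.
  apply: ler_wpM2r => //; rewrite ler_sqrt // ler_nat.
  have := card_orthoset (A := A) (z := z); rewrite EQ // => /(_ j0).
  have -> : (#|F| ^ d = #|F| ^ d.-1 * #|F|)%N by rewrite -expnSr prednK.
  rewrite leq_pmul2r //.
  by apply/card_gt0P; exists 0.
apply: (@le_trans _ _ (\sum_(z in E) #|right_pairs z|)%:R); first by rewrite ler_nat add_energy_le.
rewrite natr_sum; apply: (le_trans (ler_sum _ hz)).
rewrite sumr_const -[leLHS]mulr_natl le_eqVlt; apply/orP; left; apply/eqP.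
ring.
Qed.

End Energy.

(** * Size of the sphere, and the plane *)

(** Double counting of the pairs [(u, t)] with [P (u + t *: z)]: for fixed [t], translation gives
    the full count of [P]. *)
Lemma card_fibers_le (F : finFieldType) (d k : nat) (z : 'rV[F]_d) (P : pred 'rV[F]_d) :
  (forall u, #|[set t : F | P (u + t *: z)%R]| <= k)%N ->
  (#|F| * #|[set u | P u]| <= k * #|F| ^ d)%N.
Proof.
move=> hk.
have -> : (#|F| * #|[set u | P u]| = \sum_u #|[set t : F | P (u + t *: z)%R]|)%N.
  transitivity (\sum_(t : F) \sum_(u : 'rV[F]_d) (P (u + t *: z)%R : nat))%N.
    rewrite -sum_nat_const; apply: eq_bigr => t _.
    rewrite -sum1_card (reindex_inj (addIr (t *: z))) /= big_mkcond /=.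
    by apply: eq_bigr => u _; rewrite inE; case: (P _).
  rewrite exchange_big /=; apply: eq_bigr => u _.
  rewrite -sum1_card [RHS]big_mkcond /=.
  by apply: eq_bigr => t _; rewrite inE; case: (P _).
have <- : #|'rV[F]_d| = (#|F| ^ d)%N by rewrite card_mx mul1n.
by rewrite mulnC -sum_nat_const; apply: leq_sum => u _; exact: hk.
Qed.

Lemma card_roots_lt (F : finFieldType) (p : {poly F}) : p != 0 ->
  (#|[set t | (p.[t] == 0)%R]| < size p)%N.
Proof.
move=> p0; rewrite cardE; apply: max_poly_roots => //; last exact: enum_uniq.
by apply/allP => t; rewrite mem_enum inE /root.
Qed.

Lemma card_quadratic_le (F : finFieldType) (a b c : F) : c != 0 ->
  (#|[set t | (a + b * t + c * t ^+ 2 == 0)%R]| <= 2)%N.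
Proof.
move=> c0; pose p := Poly [:: a; b; c].
have p0 : p != 0 by apply: contraNneq c0 => e; have := coef_Poly [:: a; b; c] 2; rewrite -/p e coef0 => /= <-.
have := leq_trans (card_roots_lt p0) (size_Poly _); rewrite ltnS; apply: leq_trans.
apply: subset_leq_card; apply/subsetP => t; rewrite !inE horner_Poly /= => /eqP e.
by apply/eqP; rewrite -[RHS]e; ring.
Qed.

Lemma card_linear_le (F : finFieldType) (a b : F) : b != 0 ->
  (#|[set t | (a + b * t == 0)%R]| <= 1)%N.
Proof.
move=> b0; apply: (@leq_trans #|[set - a / b]|); last by rewrite cards1.
apply: subset_leq_card; apply/subsetP => t; rewrite !inE addrC addr_eq0 => /eqP e.
by rewrite -e mulrC mulKf.
Qed.

Section Sphere.
Variables (F : finFieldType) (d : nat) (A : 'M[F]_d).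
Hypotheses (F2 : 2%N \notin [pchar F]) (Asym : A^T = A) (Aunit : A \in unitmx).
Variable j : F.
Hypothesis j0 : j != 0.
Local Notation B := (bform A).
Local Notation S := (qsphere A j).

Section Card.
Variable z : 'rV[F]_d.
Hypothesis zS : z \in S.
Let Qz : B z z = j := qsphere_bform zS.

Let q_gt0 : (0 < #|F|)%N. Proof. by apply/card_gt0P; exists 0. Qed.

Lemma bform_line u t : B (u + t *: z) (u + t *: z) = B u u + (2 * B u z) * t + j * t ^+ 2.
Proof. by rewrite bform_sqrD // bformZl !bformZr Qz; ring. Qed.

(** On a line in direction [z] the form is quadratic in [t] with leading coefficient [j], so at most
    two points lie on the sphere. *)
Lemma card_qsphere_le : (#|F| * #|S| <= 2 * #|F| ^ d)%N.
Proof.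
apply: (card_fibers_le (z := z) (P := fun u => quad_form A u == j)) => u.
apply: leq_trans (card_quadratic_le (B u u - j) (2 * B u z) j0).
apply: subset_leq_card; apply/subsetP => t; rewrite !inE quad_formE bform_line => /eqP e.
by apply/eqP; rewrite -[RHS](subrr j) -[X in _ = X - _]e; ring.
Qed.

(** The reflection of [z] in a non-isotropic [u] stays on the sphere. If moreover [B u z != 0], the
    image together with the coefficient [c u] recovers [u], so the good directions number at most
    [#|S| * #|F|]. *)
Lemma card_qsphere_ge : (1 < d)%N -> (#|F| ^ d.-1 <= 3 ^ d * #|S|)%N.
Proof.
move=> d1; have S0 : (0 < #|S|)%N by apply/card_gt0P; exists z.
(* Bad directions may number [3 * #|F| ^ d.-1], which is useless for three elements. There the
   factor [3 ^ d] suffices, since the sphere is nonempty. *)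
have [q3|q4] := leqP #|F| 3.
  apply: (@leq_trans (3 ^ d)); last by rewrite leq_pmulr.
  apply: (@leq_trans (3 ^ d.-1)); first by rewrite leq_exp2r ?q3 // -ltnS prednK // ltnW.
  by rewrite leq_exp2l // leq_pred.
pose bad := [set u | (B u u == 0) || (B u z == 0)].
have hbad : (#|F| * #|bad| <= 3 * #|F| ^ d)%N.
  apply: (card_fibers_le (z := z) (P := fun u => (B u u == 0) || (B u z == 0))) => u.
  (* On each line, two roots for [B u u = 0] and one for [B u z = 0] give the 3. *)
  apply: leq_trans (leq_add (card_quadratic_le (B u u) (2 * B u z) j0) (card_linear_le (B u z) j0)).
  apply: leq_trans (leq_card_setU _ _); apply: subset_leq_card.
  apply/subsetP => t; by rewrite !inE bform_line bformDl bformZl Qz (mulrC t j).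
have hgood : (#|~: bad| <= #|S| * #|F|)%N.
  pose c u := 2 * B z u / B u u.
  rewrite -[#|F|]cardsT -cardsX -(card_in_imset (f := fun u => (z - c u *: u, c u))).
    apply: subset_leq_card; apply/subsetP => _ /imsetP[u + ->].
    rewrite !inE negb_or => /andP[Qu0 _]; rewrite /= andbT quad_formE.
    rewrite bform_sqrD // bformNl !bformNr bformZl !bformZr Qz /c.
    by apply/eqP; field.
  move=> u v; rewrite !inE !negb_or => /andP[u1 u2] /andP[v1 v2] [e1 e2].
  move: e1; rewrite -e2 => /addrI/oppr_inj.
  have cu : c u != 0.
    by rewrite mulf_eq0 mulf_eq0 invr_eq0 (negPf (two_neq0 F2)) bformC // (negPf u1) (negPf u2).
  exact: (scalerI cu).
have tot : (#|bad| + #|~: bad| = #|F| ^ d)%N by rewrite cardsC card_mx mul1n.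
have e : (#|F| ^ d = #|F| ^ d.-1 * #|F|)%N by rewrite -expnSr prednK // ltnW.
have h9 : (9 <= 3 ^ d)%N by rewrite (@leq_exp2l 3 2).
move: hbad hgood tot; rewrite {}e.
move: S0 q4 h9; move: (#|F| ^ d.-1)%N => Q; move: #|bad| #|~: bad| #|F| #|S| (3 ^ d)%N.
move=> b g q s t _ q4 t9 hb hg tot; clear -q4 t9 hb hg tot.
have q0 : (0 < q)%N by lia.
have b3 : (b <= 3 * Q)%N by rewrite -(leq_pmul2l q0) mulnCA [(q * Q)%N]mulnC.
have qQ : (4 * Q <= Q * q)%N by rewrite mulnC leq_mul2l q4 orbT.
have : (Q * q <= 4 * s * q)%N by rewrite -mulnA; lia.
rewrite leq_pmul2r //.
by move=> h; apply: leq_trans h _; apply: leq_mul => //; lia.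
Qed.

End Card.

(** * Additive energy in dimension two *)

Section Plane.
Hypothesis d2 : d = 2%N.
Variable E : {set 'rV[F]_d}.
Hypothesis ES : E \subset S.

Section Point.
Variable z : 'rV[F]_d.
Hypothesis zE : z \in E.
Let Qz : B z z = j := qsphere_bform (subsetP ES z zE).
Let z0 : B z z != 0. Proof. by rewrite Qz. Qed.

(** The multiples of [e] already exhaust the bound of [card_orthoset] when [d = 2]. *)
Lemma orthoset_line e v : e \in orthoset A z -> e != 0 -> v \in orthoset A z ->
  exists t, v = t *: e.
Proof.
move=> eU e0 vU; pose L := [set t *: e | t in [set: F]].
have cL : #|L| = #|F|.
  rewrite card_imset ?cardsT // => s t h; apply/eqP; rewrite -subr_eq0.
  by have /eqP := h; rewrite -subr_eq0 -scalerBl scaler_eq0 (negPf e0) orbF.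
have LU : L \subset orthoset A z.
  apply/subsetP => _ /imsetP[t _ ->]; move: eU; rewrite !inE bformZl => /eqP ->.
  by rewrite mulr0.
have /eqP UL : L == orthoset A z.
  rewrite eqEcard LU cL; have := card_orthoset z0.
  have -> : (#|F| ^ d = #|F| * #|F|)%N by rewrite d2 mulnn.
  rewrite leq_pmul2r //.
  by apply/card_gt0P; exists 0.
by move: vU; rewrite -UL => /imsetP[t _ ->]; exists t.
Qed.

(** Otherwise [x - z] spans the line [orthoset A z] and is isotropic, since [x] and [z] both lie on
    the sphere; this contradicts [orthoset_nondeg]. *)
Lemma plane_transverse x : x \in E -> x != z -> B (x - z) z != 0.
Proof.
move=> xE xz; apply/negP => h.
have eU : x - z \in orthoset A z by rewrite inE.
have e0 : x - z != 0 by rewrite subr_eq0.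
have [v vU] := orthoset_nondeg Asym Aunit z0 eU e0.
have [t ->] := orthoset_line eU e0 vU.
have : B (x - z + z) (x - z + z) = j by rewrite subrK (qsphere_bform (subsetP ES x xE)).
rewrite bform_sqrD // (eqP h) Qz mulr0 addr0 => /(canRL (addrK _)); rewrite subrr bformZl => ->.
by rewrite mulr0 eqxx.
Qed.

(** Three families contribute at most [#|E|] pairs each: first point [z], second point [z], neither.
    In the last one the first point determines the second, because [B v w = - j] has at most one
    solution [w] on a line. *)
Lemma right_pairs_plane_le : (#|right_pairs A E z| <= 3 * #|E|)%N.
Proof.
pose P1 := [set p in right_pairs A E z | p.1 == z].
pose P2 := [set p in right_pairs A E z | p.2 == z].
pose P3 := [set p in right_pairs A E z | (p.1 != z) && (p.2 != z)].
have cover : right_pairs A E z \subset P1 :|: (P2 :|: P3).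
  apply/subsetP => p; rewrite !inE => ->.
  by case: eqP => // _; case: eqP.
apply: (leq_trans (subset_leq_card cover)).
apply: (leq_trans (leq_card_setU _ _)); rewrite (_ : 3 = 1 + (1 + 1))%N // !mulnDl !mul1n.
apply: leq_add; last apply: (leq_trans (leq_card_setU _ _)); last apply: leq_add.
- rewrite -(card_in_imset (f := snd)).
    by apply: subset_leq_card; apply/subsetP => _ /imsetP[p + ->]; rewrite !inE => /andP[/andP[/andP[]]].
  by move=> [x y] [x' y']; rewrite !inE /= => /andP[_ /eqP ->] /andP[_ /eqP ->] ->.
- rewrite -(card_in_imset (f := fst)).
    by apply: subset_leq_card; apply/subsetP => _ /imsetP[p + ->]; rewrite !inE => /andP[/andP[/andP[]]].
  by move=> [x y] [x' y']; rewrite !inE /= => /andP[_ /eqP ->] /andP[_ /eqP ->] ->.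
rewrite -(card_in_imset (f := fst)).
  by apply: subset_leq_card; apply/subsetP => _ /imsetP[p + ->]; rewrite !inE => /andP[/andP[/andP[]]].
move=> [x y] [x' y'] h h' /= xx; rewrite -{x'}xx in h' *.
move: h h'; rewrite !inE /= => /andP[/andP[/andP[xE yE] hy] /andP[xz yz]].
move=> /andP[/andP[/andP[_ yE'] hy'] /andP[_ yz']]; congr (_, _).
have tx := plane_transverse xE xz.
have rel w : w \in E -> w != z -> B (x - z) (w - z) == 0 -> B (stereo A j z x) (stereo A j z w) = - j.
  move=> wE wz; have tw := plane_transverse wE wz.
  have := stereo_orthoset ES zE tx; have := stereo_orthoset ES zE tw.
  rewrite ![_ \in orthoset _ _]inE => /eqP vw /eqP vx.
  rewrite {1}(stereoK j0 tx) {1}(stereoK j0 tw) bformZl bformZr !mulf_eq0.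
  rewrite !invr_eq0 (negPf tx) (negPf tw) (negPf j0) /=.
  rewrite (bformDl A (stereo A j z x) z) (bformDr A (stereo A j z x)) (bformDr A z).
  by rewrite vx (bformC Asym z) vw Qz !addr0 add0r addr_eq0 => /eqP.
apply: (stereo_inj F2 Asym j0 ES zE); rewrite ?inE ?yE ?yE' ?plane_transverse //.
have r := rel _ yE yz hy; have r' := rel _ yE' yz' hy'.
set v := stereo A j z x in r r'; set w := stereo A j z y in r *.
set w' := stereo A j z y' in r' *.
have vU : v \in orthoset A z by exact: (stereo_orthoset ES zE).
have wU : w \in orthoset A z by apply: (stereo_orthoset ES zE); exact: plane_transverse.
have wU' : w' \in orthoset A z by apply: (stereo_orthoset ES zE); exact: plane_transverse.
(* If [w != w'], then [w - w'] spans the line and is orthogonal to [v], whence [B v w = 0] instead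
   of [- j]. *)
apply/eqP; rewrite -subr_eq0; apply: contraT => e0.
have eU : w - w' \in orthoset A z.
  have := wU; have := wU'; rewrite !inE => /eqP hw' /eqP hw.
  by rewrite (bformDl A w (- w')) bformNl hw hw' subr0.
have ve : B v (w - w') = 0 by rewrite (bformDr A v w) bformNr r r' subrr.
have [t ht] := orthoset_line eU e0 wU.
by move: r; rewrite ht bformZr ve mulr0 => /esym/eqP; rewrite oppr_eq0 (negPf j0).
Qed.
End Point.

Lemma add_energy_plane_le : (add_energy E <= 3 * #|E| ^ 2)%N.
Proof.
apply: (leq_trans (add_energy_le F2 Asym ES)).
rewrite -mulnn mulnA mulnC -sum_nat_const; apply: leq_sum => z zE.
exact: right_pairs_plane_le.
Qed.

End Plane.
End Sphere.

(** * Real exponents *)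

Section RealPowers.
Variable R : realType.
Implicit Types q n s r p a b x : R.

(** Also valid at [a = 0]: since [r] is nonzero, [x] and [r - x] do not both vanish, so both sides
    are 0. *)
Lemma powR_split a x r : 0 < r -> a `^ r = a `^ x * a `^ (r - x).
Proof. by move=> r0; rewrite -powRD addrC subrK // gt_eqF. Qed.

Lemma powR_root a r : 0 <= a -> 0 < r -> (a `^ r) `^ r^-1 = a.
Proof. by move=> a0 r0; rewrite -powRrM divff ?gt_eqF // powRr1. Qed.

Lemma powR_le1D (t s : R) : 0 <= t -> 0 <= s -> s <= 1 -> t `^ s <= 1 + t.
Proof.
move=> t0 s0 s1; have [t1|t1] := leP t 1.
  apply: (@le_trans _ _ 1); last by rewrite lerDl.
  have e : 1 `^ s = 1 :> R by rewrite powR1.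
  by rewrite -[leRHS]e; apply: ge0_ler_powR; rewrite ?nnegrE.
by apply: le_trans (ler1_powR (ltW t1) s1) _; rewrite lerDr.
Qed.

(** Every [a i] is at most the [r]-norm [N], so [a i] to the power [r'] is at most [N] to the power
    [r' - r] times [a i] to the power [r]. *)
Lemma lr_norm_mono (I : finType) (a : I -> R) r r' : 0 < r -> r <= r' ->
  (forall i, 0 <= a i) ->
  (\sum_i a i `^ r') `^ r'^-1 <= (\sum_i a i `^ r) `^ r^-1.
Proof.
move=> r0 rr a0; have r'0 : 0 < r' by exact: lt_le_trans rr.
set N := (\sum_i a i `^ r) `^ r^-1.
have N0 : 0 <= N by exact: powR_ge0.
have s0 : 0 <= \sum_i a i `^ r by apply: sumr_ge0 => i _; exact: powR_ge0.
have Nr : N `^ r = \sum_i a i `^ r.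
  by rewrite /N -powRrM mulVf ?gt_eqF // powRr1.
have aN i : a i <= N.
  rewrite -(powR_root (a0 i) r0); apply: ge0_ler_powR; rewrite ?nnegrE ?powR_ge0 ?invr_ge0 ?s0 ?(ltW r0) //.
  by rewrite (bigD1 i) //= lerDl; apply: sumr_ge0 => k _; exact: powR_ge0.
rewrite -[leRHS](powR_root N0 r'0); apply: ge0_ler_powR; rewrite ?nnegrE ?powR_ge0 ?invr_ge0 ?(ltW r'0) //.
  by apply: sumr_ge0 => i _; exact: powR_ge0.
rewrite (powR_split N r r'0) Nr mulr_suml; apply: ler_sum => i _.
rewrite (powR_split (a i) r r'0); apply: ler_wpM2l; first exact: powR_ge0.
by apply: ge0_ler_powR; rewrite ?nnegrE ?subr_ge0.
Qed.

Lemma sum_powR_le_sup (I : finType) (a : I -> R) (k : nat) r n :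
  0 < r -> k%:R <= r -> (forall i, 0 <= a i <= n) ->
  \sum_i a i `^ r <= n `^ (r - k%:R) * \sum_i a i ^+ k.
Proof.
move=> r0 kr han; rewrite mulr_sumr; apply: ler_sum => i _.
have /andP[a0 an] := han i.
rewrite (powR_split _ k%:R r0) powR_mulrn // mulrC; apply: ler_wpM2r; first exact: exprn_ge0.
by apply: ge0_ler_powR; rewrite ?nnegrE ?subr_ge0 // (le_trans a0).
Qed.

(* Interpolates between the second and the fourth moment; the choice of [lam]
   balancing the two terms replaces Hoelder's inequality. *)
Lemma sum_powR_interpolate (I : finType) (a : I -> R) s lam :
  0 <= s -> s <= 1 -> 0 < lam -> (forall i, 0 <= a i) ->
  \sum_i a i `^ (2 + 2 * s) <= lam `^ s * (\sum_i a i ^+ 2 + (\sum_i a i ^+ 4) / lam).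
Proof.
move=> s0 s1 l0 a0; rewrite mulr_suml -big_split /= mulr_sumr; apply: ler_sum => i _.
have h : (a i ^+ 2 / lam) `^ s <= 1 + a i ^+ 2 / lam.
  by apply: powR_le1D => //; rewrite divr_ge0 ?sqr_ge0 // ltW.
rewrite (powR_split _ 2%:R); last by lra.
rewrite powR_mulrn // (_ : 2 + 2 * s - 2%:R = 2%:R * s); last by ring.
rewrite powRrM powR_mulrn //.
rewrite -{2}(divfK (lt0r_neq0 l0) (a i ^+ 2)) powRM ?divr_ge0 ?sqr_ge0 ?(ltW l0) //.
rewrite [leLHS]mulrA [leLHS]mulrC; apply: ler_wpM2l; first exact: powR_ge0.
apply: le_trans (ler_wpM2l (sqr_ge0 _) h) _.
by rewrite le_eqVlt; apply/orP; left; apply/eqP; field; rewrite lt0r_neq0.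
Qed.

(** Here [M] is an [r]-th moment, [s] the size of the sphere, and [rho / r] becomes [1 / p]. Keeping
    [n / s] to the power [rho], the surplus powers of [n] and [s] are traded for powers of [q]
    through [hn] and [hs]. *)
Lemma exponent_balance q n s r rho A b g k C1 c2 c M :
  1 <= q -> 0 < n -> 0 < c -> 0 < c2 -> 0 < C1 -> 0 <= M ->
  0 < r -> rho <= r -> rho <= b ->
  n <= c2 * q `^ g -> c * q `^ k <= s ->
  A + g * (b - rho) = k * (r - rho) ->
  M <= C1 * q `^ A * n `^ b ->
  (s^-1 `^ r * M) `^ r^-1
    <= (C1 * c2 `^ (b - rho) * c `^ (rho - r)) `^ r^-1 * (n / s) `^ (rho / r).
Proof.
move=> q1 n0 c0 c20 C10 M0 r0 rr rb hn hs hA hM.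
have q0 : 0 < q by exact: lt_le_trans q1.
have s0 : 0 < s by apply: lt_le_trans hs; rewrite mulr_gt0 // powR_gt0.
have D x u v : 0 < x -> x `^ (u + v) = x `^ u * x `^ v.
  by move=> x0; rewrite powRD //; apply/implyP => _; rewrite gt_eqF.
rewrite powRrM -powRM ?powR_ge0 ?mulr_ge0 ?powR_ge0 ?(ltW C10) //.
apply: ge0_ler_powR; rewrite ?nnegrE ?invr_ge0 ?(ltW r0) ?mulr_ge0 ?powR_ge0 ?(ltW C10) //.
rewrite powRM ?invr_ge0 ?(ltW n0) ?(ltW s0) //.
have inv x y : 0 < x -> x^-1 `^ y = x `^ (- y).
  by move=> x0; rewrite -powR_inv1 ?ltW // -powRrM mulN1r.
rewrite !inv //.
have -> : s `^ (- r) = s `^ (- rho) * s `^ (rho - r).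
  by rewrite -D //; congr (_ `^ _); ring.
have h1 : s `^ (rho - r) <= c `^ (rho - r) * q `^ (- (k * (r - rho))).
  rewrite (_ : rho - r = - (r - rho)); last by ring.
  rewrite -mulrN (powRrM q) -powRM ?powR_ge0 ?(ltW c0) // !powRN lef_pV2 ?posrE ?powR_gt0 ?mulr_gt0 ?powR_gt0 //.
  by apply: ge0_ler_powR; rewrite ?nnegrE ?subr_ge0 ?mulr_ge0 ?powR_ge0 ?(ltW c0) ?(ltW s0).
have h2 : n `^ b <= n `^ rho * (c2 `^ (b - rho) * q `^ (g * (b - rho))).
  have -> : n `^ b = n `^ rho * n `^ (b - rho) by rewrite -D // addrC subrK.
  apply: ler_wpM2l; first exact: powR_ge0.
  rewrite powRrM -powRM ?powR_ge0 ?(ltW c20) //.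
  by apply: ge0_ler_powR; rewrite ?nnegrE ?subr_ge0 ?mulr_ge0 ?powR_ge0 ?(ltW c20) ?(ltW n0).
have h3 : M <= C1 * q `^ A * (n `^ rho * (c2 `^ (b - rho) * q `^ (g * (b - rho)))).
  by apply: le_trans hM _; apply: ler_wpM2l => //; rewrite mulr_ge0 ?powR_ge0 ?ltW.
(* The identity [hA] says exactly that all powers of [q] cancel. *)
have hq : q `^ (- (k * (r - rho))) * (q `^ A * q `^ (g * (b - rho))) = 1.
  by rewrite -!D // hA addNr powRr0.
have h4 := ler_wpM2l (powR_ge0 s (- rho)) (ler_pM (powR_ge0 _ _) M0 h1 h3).
rewrite -[leLHS]mulrA; apply: (le_trans h4); rewrite le_eqVlt; apply/orP; left; apply/eqP.
by rewrite -[RHS]mulr1 -hq; ring.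
Qed.
End RealPowers.

(** * Extension estimates *)

Section Extension.
Variables (R : realType) (F : finFieldType) (d : nat) (A : 'M[F]_d).
Hypotheses (d1 : (1 < d)%N) (F2 : 2%N \notin [pchar F]).
Hypotheses (Asym : A^T = A) (Aunit : A \in unitmx).
Variable j : F.
Hypothesis j0 : j != 0.
Variable chi : F -> R[i].
Hypothesis chiP : nontriv_add_char chi.
Variable E : {set 'rV[F]_d}.
Hypotheses (ES : E \subset qsphere A j) (E0 : (0 < #|E|)%N).

Local Notation S := (qsphere A j).
Local Notation q := (#|F|%:R : R).
Local Notation n := (#|E|%:R : R).
Local Notation a := (fun m => Normc.normc (expsum chi E m)).

Let q_ge1 : 1 <= q.
Proof. by rewrite ler1n; apply/card_gt0P; exists 0. Qed.

Let q_gt0 : 0 < q. Proof. exact: lt_le_trans q_ge1. Qed.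

Let n_gt0 : 0 < n. Proof. by rewrite ltr0n. Qed.

Let S_gt0 : (0 < #|S|)%N.
Proof. exact: leq_trans (subset_leq_card ES). Qed.

Let D x u v : 0 < x -> x `^ (u + v) = x `^ u * x `^ v :> R.
Proof. by move=> x0; rewrite powRD //; apply/implyP => _; rewrite gt_eqF. Qed.

Lemma normc_nat k : Normc.normc (k%:R : R[i]) = k%:R.
Proof. by apply: (@complexI R); rewrite rmorph_nat; exact: (normr_nat R[i]). Qed.

Lemma ext_hat_indC m : ext_hat chi S (indC E) m = #|S|%:R^-1 * expsum chi E m.
Proof.
rewrite /ext_hat (big_setID E) /= (setIidPr ES) [X in _ + X]big1 ?addr0; last first.
  by move=> x; rewrite inE /indC => /andP[/negPf -> _]; rewrite mulr0.
by congr (_ * _); apply: eq_bigr => x xE; rewrite /indC xE mulr1.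
Qed.

Lemma norm_Lr_ext_hat r : norm_Lr_dm (ext_hat chi S (indC E)) r
  = (#|S|%:R^-1 `^ r * \sum_m a m `^ r) `^ r^-1.
Proof.
rewrite /norm_Lr_dm mulr_sumr; congr (_ `^ _); apply: eq_bigr => m _.
by rewrite ext_hat_indC Normc.normcM Normc.normcV normc_nat powRM ?invr_ge0 ?normc_ge0.
Qed.

Lemma norm_Lp_indR p : p != 0 -> norm_Lp_dsigma S (indR E) p = (n / #|S|%:R) `^ p^-1.
Proof.
move=> p0; rewrite /norm_Lp_dsigma mulrC; congr ((_ / _) `^ _).
rewrite (big_setID E) /= (setIidPr ES) [X in _ + X]big1 ?addr0; last first.
  by move=> x; rewrite inE /indR => /andP[/negPf -> _]; rewrite normr0 powR0.
rewrite -sum1_card natr_sum; apply: eq_bigr => x xE.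
by rewrite /indR xE normr1 powR1.
Qed.

Lemma expsum_powR_le (r : R) : 2 <= r -> \sum_m a m `^ r <= 1 * q `^ d%:R * n `^ (r - 1).
Proof.
move=> r2; apply: (le_trans (@sum_powR_le_sup _ _ _ 2 r n _ _ _)); try lra.
  by move=> m; rewrite normc_ge0 normc_expsum_le.
rewrite expsum_sqr // natrM natrX powR_mulrn ?(ltW q_gt0) // mul1r mulrCA.
rewrite (_ : r - 1 = (r - 2%:R) + 1); last by ring.
by rewrite (D (r - 2%:R) 1) // powRr1.
Qed.

Lemma expsum_powR_plane_le (r : R) : d = 2%N -> 4 <= r ->
  \sum_m a m `^ r <= 3 * q `^ d%:R * n `^ (r - 2).
Proof.
move=> d2 r4; have r0 : 0 < r by exact: lt_le_trans r4.
apply: (le_trans (@sum_powR_le_sup _ _ _ 4 r n r0 r4 _)).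
  by move=> m; rewrite normc_ge0 normc_expsum_le.
rewrite expsum_pow4 // natrM natrX powR_mulrn ?(ltW q_gt0) //.
rewrite (_ : r - 2 = (r - 4%:R) + 2%:R); last by ring.
rewrite (D (r - 4%:R) 2%:R) // powR_mulrn // (mulrC 3) -[leRHS]mulrA [leLHS]mulrCA.
apply: ler_wpM2l; first exact: exprn_ge0.
rewrite mulrCA; apply: ler_wpM2l; first exact: powR_ge0.
by rewrite -natrX -natrM ler_nat (add_energy_plane_le F2 Asym Aunit j0).
Qed.

Lemma expsum_powR_interpolate_le (s c2 : R) : 0 <= s -> s <= 1 -> 0 < c2 ->
  n <= c2 * q `^ ((d%:R + 1) / 2) ->
  \sum_m a m `^ (2 + 2 * s)
    <= (5 + 4 * c2) * q `^ (d%:R + s * ((d%:R - 1) / 2)) * n `^ (1 + s).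
Proof.
move=> s0 s1 c20 hn; set w := q `^ ((d%:R - 1) / 2).
have w0 : 0 < w by exact: powR_gt0.
have sqw : Num.sqrt (#|F| ^ d.-1)%:R = w.
  rewrite natrX -powR12_sqrt; last by rewrite exprn_ge0.
  rewrite -powR_mulrn ?ler0n // -powRrM.
  by rewrite -subn1 natrB // ltnW.
have hq : q `^ ((d%:R + 1) / 2) = q * w.
  rewrite (_ : (d%:R + 1) / 2 = 1 + (d%:R - 1) / 2); last by field.
  by rewrite D // powRr1 ?(ltW q_gt0).
(* The size hypothesis makes [n ^+ 3 / q] at most [c2 * w * n ^+ 2], so both terms of the energy
   bound have the order [w * n ^+ 2]. *)
have en : (add_energy E)%:R <= 4 * (c2 + 1) * (w * n) * n.
  have := add_energy_bound F2 Asym Aunit j0 ES chiP (ltnW d1); rewrite sqw => /le_trans; apply.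
  rewrite (_ : 4 * (c2 + 1) * (w * n) * n = 4 * (c2 * w * n ^+ 2 + w * n ^+ 2)); last by ring.
  apply: ler_wpM2l => //; rewrite lerD2r.
  rewrite ler_pdivrMr // (_ : c2 * w * n ^+ 2 * q = n ^+ 2 * (c2 * (q * w))); last by ring.
  by rewrite exprSr ler_wpM2l ?sqr_ge0 // -hq.
(* The interpolation parameter is [w * n], the order of the fourth moment bound over the second
   moment. The constant is [5 + 4 * c2 = 1 + 4 * (c2 + 1)]. *)
have l0 : 0 < w * n by exact: mulr_gt0.
apply: (le_trans (sum_powR_interpolate s0 s1 l0 (fun m => normc_ge0 _))).
rewrite expsum_sqr // expsum_pow4 // !natrM natrX.
have -> : (5 + 4 * c2) * q `^ (d%:R + s * ((d%:R - 1) / 2)) * n `^ (1 + s)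
    = (w * n) `^ s * ((5 + 4 * c2) * q ^+ d * n).
  rewrite powRM ?(ltW w0) // !D // powRr1 // powR_mulrn ?(ltW q_gt0) // /w -powRrM (mulrC s).
  by ring.
apply: ler_wpM2l; first exact: powR_ge0.
rewrite (_ : (5 + 4 * c2) * q ^+ d * n = q ^+ d * n + q ^+ d * (4 * (c2 + 1) * n)); last by ring.
rewrite lerD2l -mulrA ler_wpM2l ?exprn_ge0 // ler_pdivrMr //.
by apply: le_trans en _; rewrite le_eqVlt; apply/orP; left; apply/eqP; ring.
Qed.

(** Reduction to the extreme exponents [r0] and [p0]: the counting norm decreases in [r], the
    normalised norm increases in [p]. Here [rho] is [r0 / p0], and [(3 ^+ d)^-1] comes from
    [card_qsphere_ge]. *)
Lemma extension_of_moment (C1 c2 e b g rho r0 p0 r p : R) :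
  0 < C1 -> 0 < c2 -> 0 < r0 -> r0 <= r -> 0 < p0 -> p0 <= p ->
  p0^-1 = rho / r0 -> rho <= r0 -> rho <= b ->
  e + g * (b - rho) = (d%:R - 1) * (r0 - rho) ->
  n <= c2 * q `^ g ->
  \sum_m a m `^ r0 <= C1 * q `^ e * n `^ b ->
  norm_Lr_dm (ext_hat chi S (indC E)) r
    <= (C1 * c2 `^ (b - rho) * (3 ^+ d)^-1 `^ (rho - r0)) `^ r0^-1
       * norm_Lp_dsigma S (indR E) p.
Proof.
move=> C10 c20 r00 rr p00 pp hp rho_r rho_b he hn hM.
have s0 : 0 < #|S|%:R :> R by rewrite ltr0n.
have p_gt0 : 0 < p by exact: lt_le_trans pp.
apply: le_trans (lr_norm_mono r00 rr (fun m => normc_ge0 _)) _.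
rewrite -/(norm_Lr_dm _ r0) norm_Lr_ext_hat.
have t0 : 0 < (3 ^+ d)^-1 :> R by rewrite invr_gt0 exprn_gt0.
have hS : (3 ^+ d)^-1 * q `^ (d%:R - 1) <= #|S|%:R.
  have [z zE] : exists z, z \in E by apply/card_gt0P.
  have := card_qsphere_ge F2 Asym j0 (subsetP ES z zE) d1.
  rewrite -(ler_nat R) natrM !natrX -powR_mulrn ?(ltW q_gt0) // -subn1 natrB; last exact: ltnW.
  by move=> h; rewrite mulrC ler_pdivrMr ?exprn_gt0 // mulrC.
apply: le_trans (exponent_balance q_ge1 n_gt0 t0 c20 C10 _ r00 rho_r rho_b hn hS he hM) _.
  by apply: sumr_ge0 => m _; exact: powR_ge0.
apply: ler_wpM2l; first exact: powR_ge0.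
rewrite norm_Lp_indR ?gt_eqF // -hp; apply: ger_powR.
  by rewrite divr_gt0 //= ler_pdivrMr // mul1r ler_nat subset_leq_card.
by rewrite lef_pV2 ?posrE.
Qed.

End Extension.

(** * The two size ranges at their extreme exponents *)

Theorem theorem1p4 (R : realType) (d : nat) (p0 : R) :
  (2 <= d)%N -> 2 <= p0 ->
  (* (i) *)
  (forall p r : R,
     ((6 * d%:R - 2) * p0 - 8 * d%:R + 8) / ((3 * d%:R - 5) * p0 - 4 * d%:R + 12) <= p ->
     ((6 * d%:R - 2) * p0 - 8 * d%:R + 8) / ((3 * d%:R - 3) * p0 - 4 * d%:R + 4) <= r ->
     forall c1 c2 : R, 0 < c1 -> 0 < c2 ->
     exists C : R, 0 < C /\
       forall (F : finFieldType), 2%N \notin [pchar F] ->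
       forall (A : 'M[F]_d), A^T = A -> A \in unitmx ->
       forall j : F, j != 0 ->
       forall chi : F -> R[i], nontriv_add_char chi ->
       forall E : {set 'rV[F]_d}, E \subset qsphere A j ->
       c1 <= #|E|%:R <= c2 * (#|F|%:R) `^ ((d%:R - 1) / 2) ->
       norm_Lr_dm (ext_hat chi (qsphere A j) (indC E)) r
         <= C * norm_Lp_dsigma (qsphere A j) (indR E) p)
  /\
  (* (ii) *)
  (forall p r : R,
     0 < (3 * d%:R - 9) * p0 - 4 * d%:R + 20 ->
     0 < (3 * d%:R - 7) * p0 - 4 * d%:R + 12 ->
     ((6 * d%:R - 10) * p0 - 8 * d%:R + 24) / ((3 * d%:R - 9) * p0 - 4 * d%:R + 20) <= p ->
     ((6 * d%:R - 10) * p0 - 8 * d%:R + 24) / ((3 * d%:R - 7) * p0 - 4 * d%:R + 12) <= r ->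
     forall c1 c2 : R, 0 < c1 -> 0 < c2 ->
     exists C : R, 0 < C /\
       forall (F : finFieldType), 2%N \notin [pchar F] ->
       forall (A : 'M[F]_d), A^T = A -> A \in unitmx ->
       forall j : F, j != 0 ->
       forall chi : F -> R[i], nontriv_add_char chi ->
       forall E : {set 'rV[F]_d}, E \subset qsphere A j ->
       c1 <= #|E|%:R <= c2 * (#|F|%:R) `^ ((d%:R + 1) / 2) ->
       norm_Lr_dm (ext_hat chi (qsphere A j) (indC E)) r
         <= C * norm_Lp_dsigma (qsphere A j) (indR E) p).
Proof.
move=> d2 hp0.
have d2R : 2 <= d%:R :> R by rewrite ler_nat.
split=> [p r hp hr c1 c2 c10 c20|p r Np0 Nr0 hp hr c1 c2 c10 c20].
- have Nr0 : 0 < (3 * d%:R - 3) * p0 - 4 * d%:R + 4 by nra.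
  have Np0 : 0 < (3 * d%:R - 5) * p0 - 4 * d%:R + 12 by nra.
  set Nr := _ + 4 in Nr0 hr; set Np := _ + 12 in Np0 hp.
  set N := _ + 8 in hp hr.
  have N0 : 0 < N by rewrite /N; nra.
  have Nr_neq0 := lt0r_neq0 Nr0.
  (* The constant of [extension_of_moment] for [r0 = N / Nr], [p0 = N / Np], hence [rho = Np / Nr];
     [C1 = 1] and [b = r0 - 1] come from [expsum_powR_le]. *)
  exists ((1 * c2 `^ (N / Nr - 1 - Np / Nr) * (3 ^+ d)^-1 `^ (Np / Nr - N / Nr)) `^ (N / Nr)^-1).
  split.
    by rewrite powR_gt0 // !mulr_gt0 ?powR_gt0 // invr_gt0 exprn_gt0.
  move=> F F2 A As Au j j0 chi chiP E ES /andP[hE1 hE2].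
  have E0 : (0 < #|E|)%N by rewrite -(ltr0n R); exact: lt_le_trans hE1.
  apply: (extension_of_moment d2 F2 As j0 ES E0 (p0 := N / Np) (e := d%:R) (g := (d%:R - 1) / 2)) => //.
  + exact: divr_gt0.
  + exact: divr_gt0.
  + by field; rewrite !lt0r_neq0.
  + by rewrite ler_pM2r ?invr_gt0 // /N /Np; nra.
  + rewrite -subr_ge0.
    have -> : N / Nr - 1 - Np / Nr = (6 * p0 - 8) / Nr by rewrite /N /Nr /Np; field.
    by rewrite divr_ge0 ?(ltW Nr0) //; lra.
  + by rewrite /N /Np /Nr; field.
  + apply: expsum_powR_le => //.
    by rewrite ler_pdivlMr // /N /Nr; lra.
(* Interpolation needs the extreme [r] to be at most 4, which amounts to
   [(d - 3) * (3 * p0 - 4) >= 0]; this fails for [d = 2]. *)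
have [d3|dlt3] := leqP 3 d.
- have d3R : 3 <= d%:R :> R by rewrite ler_nat.
  set Nr := _ + 12 in Nr0 hr; set Np := _ + 20 in Np0 hp.
  set N := _ + 24 in hp hr.
  have N0 : 0 < N by rewrite /N; nra.
  have Nr_neq0 := lt0r_neq0 Nr0.
  (* Chosen so that [N / Nr = 2 + 2 * s]. *)
  pose s := 2 * p0 / Nr.
  have s0 : 0 <= s by rewrite divr_ge0 ?(ltW Nr0) //; lra.
  have s1 : s <= 1 by rewrite ler_pdivrMr // mul1r /Nr; nra.
  have rE : N / Nr = 2 + 2 * s by rewrite /s /N /Nr; field.
  exists (((5 + 4 * c2) * c2 `^ (1 + s - Np / Nr) * (3 ^+ d)^-1 `^ (Np / Nr - N / Nr)) `^ (N / Nr)^-1).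
  split.
    by rewrite powR_gt0 // !mulr_gt0 ?powR_gt0 ?invr_gt0 ?exprn_gt0 //; lra.
  move=> F F2 A As Au j j0 chi chiP E ES /andP[hE1 hE2].
  have E0 : (0 < #|E|)%N by rewrite -(ltr0n R); exact: lt_le_trans hE1.
  apply: (extension_of_moment d2 F2 As j0 ES E0 (p0 := N / Np)
    (e := d%:R + s * ((d%:R - 1) / 2)) (g := (d%:R + 1) / 2)) => //.
  + by lra.
  + exact: divr_gt0.
  + exact: divr_gt0.
  + by field; rewrite !lt0r_neq0.
  + by rewrite ler_pM2r ?invr_gt0 // /N /Np; nra.
  + rewrite -subr_ge0.
    have -> : 1 + s - Np / Nr = (4 * p0 - 8) / Nr by rewrite /s /Nr /Np; field.
    by rewrite divr_ge0 ?(ltW Nr0) //; lra.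
  + by rewrite /s /N /Np /Nr; field.
  + by rewrite rE; exact: (expsum_powR_interpolate_le d2 F2 As Au j0 chiP ES E0 s0 s1 c20 hE2).
have {dlt3} d2E : d = 2%N by apply/eqP; rewrite eqn_leq d2 -ltnS dlt3.
subst d.
(* For [d = 2] the two denominators are [4 - p0] and [3 * (4 - p0)], so the extreme exponents are
   [r0] and [r0 / 3], and [rho = 3]. *)
have p4 : 0 < 4 - p0 by lra.
pose r0 := (2 * p0 + 8) / (4 - p0).
have r5 : 5 <= r0 by rewrite ler_pdivlMr //; lra.
have {}hr : r0 <= r.
  by apply: le_trans hr; rewrite le_eqVlt; apply/orP; left; apply/eqP; rewrite /r0; field; lra.
have {}hp : r0 / 3 <= p.
  by apply: le_trans hp; rewrite le_eqVlt; apply/orP; left; apply/eqP; rewrite /r0; field; lra.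
exists ((3 * 2 `^ (r0 - 2 - 3) * (3 ^+ 2)^-1 `^ (3 - r0)) `^ r0^-1).
split.
  by rewrite powR_gt0 // !mulr_gt0 ?powR_gt0 ?invr_gt0 ?exprn_gt0.
move=> F F2 A As Au j j0 chi chiP E ES /andP[hE1 hE2].
have E0 : (0 < #|E|)%N by rewrite -(ltr0n R); exact: lt_le_trans hE1.
have r00 : 0 < r0 by lra.
apply: (extension_of_moment d2 F2 As j0 ES E0 (p0 := r0 / 3) (e := 2%:R) (g := 1)) => //.
- by rewrite divr_gt0.
- by field; rewrite lt0r_neq0.
- by lra.
- by lra.
- by lra.
(* In the plane the whole sphere has at most [2 * #|F|] points, so [g = 1] and the constant 2
   replace the weaker assumed size bound. *)
- rewrite powRr1 // -natrM ler_nat.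
  have [z zE] : exists z, z \in E by apply/card_gt0P.
  have q0 : (0 < #|F|)%N by apply/card_gt0P; exists 0.
  apply: (leq_trans (subset_leq_card ES)); rewrite -(leq_pmul2l q0).
  apply: (leq_trans (card_qsphere_le As j0 (subsetP ES z zE))).
  by rewrite mulnCA mulnn.
- by apply: (expsum_powR_plane_le F2 As Au j0) => //; lra.
Qed.
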